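(* Let $R$ be a proper normed division ring and let $M$ be a Polish $R$-vector space (Polish left $R$-module). Then exactly one of the following holds: (1) $\dim_R(M)$ is countable; (2) $\ell^1(R) \sqsubseteq^R M$.
   Context: All rings are unital. A norm on an abelian group $A$ is a function $\|\cdot\|\colon A\to[0,\infty)$ such that $(a,b)\mapsto\|a-b\|$ is a metric on $A$; it is complete/proper if this metric is complete/proper (every closed ball is compact). A norm on a ring $R$ is a norm $|\cdot|$ on $(R,+)$ with $|rs|\le|r||s|$ for all $r,s$; a proper normed ring is a ring with a proper norm, topologized by the associated metric. A division ring is a ring in which every nonzero element has a two-sided inverse. For a Polish ring $R$, a Polish $R$-module is a topological left $R$-module whose topology is Polish. For Polish $R$-modules $M,N$, write $M\sqsubseteq^R N$ if there is a continuous $R$-linear injection $M\to N$. For a proper normed ring $R$, $\ell^1(R)=\{(r_k)_{k\in\mathbb N}\in R^{\mathbb N}:\sum_k |r_k|/k!<\infty\}$ with the norm $\|(r_k)_k\|=\sum_k |r_k|/k!$; this is a Polish $R$-module with coordinatewise operations. *)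

(* Defs.v *)
From HB Require Import structures.
From mathcomp Require Import all_boot all_order all_algebra.
From mathcomp Require Import all_classical all_reals all_analysis.
From mathcomp Require Import Rstruct Rstruct_topology.

Set Implicit Arguments.
Unset Strict Implicit.
Unset Printing Implicit Defensive.

Import Order.TTheory GRing.Theory Num.Theory.
Local Open Scope ring_scope.

Notation Real := Rdefinitions.R.

Definition is_metric (T : Type) (d : T -> T -> Real) : Prop :=
  (forall x y, 0 <= d x y) /\
  (forall x y, d x y = 0 <-> x = y) /\
  (forall x y, d x y = d y x) /\
  (forall x y z, d x z <= d x y + d y z).

Definition metric_open (T : Type) (d : T -> T -> Real) (U : T -> Prop) : Prop :=
  forall x, U x -> exists e : Real, 0 < e /\ forall y, d x y < e -> U y.

Definition metric_compact (T : Type) (d : T -> T -> Real) (S : T -> Prop) : Prop :=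
  forall (I : Type) (U : I -> T -> Prop),
    (forall i, metric_open d (U i)) ->
    (forall x, S x -> exists i, U i x) ->
    exists s : seq I, forall x, S x -> exists i, List.In i s /\ U i x.

Definition metric_proper (T : Type) (d : T -> T -> Real) : Prop :=
  forall (x : T) (r : Real), metric_compact d (fun y => d x y <= r).

Definition metric_complete (T : Type) (d : T -> T -> Real) : Prop :=
  forall u : nat -> T,
    (forall e : Real, 0 < e -> exists N, forall m n, (N <= m)%N -> (N <= n)%N ->
        d (u m) (u n) < e) ->
    exists l, forall e : Real, 0 < e -> exists N, forall n, (N <= n)%N -> d (u n) l < e.

Definition norm_dist (A : zmodType) (nr : A -> Real) : A -> A -> Real :=
  fun a b => nr (a - b).

Definition ring_norm (K : pzRingType) (nr : K -> Real) : Prop :=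
  (forall x, 0 <= nr x) /\ is_metric (norm_dist nr) /\
  (forall r s, nr (r * s) <= nr r * nr s).

Definition proper_ring_norm (K : pzRingType) (nr : K -> Real) : Prop :=
  ring_norm nr /\ metric_proper (norm_dist nr).

Definition division_ring (K : unitRingType) : Prop :=
  forall x : K, x != 0 -> x \is a GRing.unit.

Definition polish_topology (M : Type) (opM : (M -> Prop) -> Prop) : Prop :=
  (exists d : M -> M -> Real, is_metric d /\ metric_complete d /\
     forall U, opM U <-> metric_open d U) /\
  (exists D : nat -> M, forall U, opM U -> forall x, U x -> exists n, U (D n)).

Definition topological_module (K : pzRingType) (nr : K -> Real) (M : lmodType K)
    (opM : (M -> Prop) -> Prop) : Prop :=
  (forall U, opM U -> forall x y : M, U (x + y) ->
     exists V W, opM V /\ opM W /\ V x /\ W y /\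
       forall x' y', V x' -> W y' -> U (x' + y')) /\
  (forall U, opM U -> forall (r : K) (x : M), U (r *: x) ->
     exists e : Real, 0 < e /\ exists W, opM W /\ W x /\
       forall r' x', nr (r' - r) < e -> W x' -> U (r' *: x')).

Definition polish_module (K : pzRingType) (nr : K -> Real) (M : lmodType K)
    (opM : (M -> Prop) -> Prop) : Prop :=
  topological_module nr opM /\ polish_topology opM.

Definition lin_indep (K : pzRingType) (M : lmodType K) (B : M -> Prop) : Prop :=
  forall (s : seq M) (c : M -> K), uniq s -> (forall b, b \in s -> B b) ->
    \sum_(b <- s) c b *: b = 0 -> forall b, b \in s -> c b = 0.

Definition spans (K : pzRingType) (M : lmodType K) (B : M -> Prop) : Prop :=
  forall x : M, exists (s : seq M) (c : M -> K),
    (forall b, b \in s -> B b) /\ x = \sum_(b <- s) c b *: b.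

Definition is_basis (K : pzRingType) (M : lmodType K) (B : M -> Prop) : Prop :=
  lin_indep B /\ spans B.

Definition countable_set (T : Type) (B : T -> Prop) : Prop :=
  exists f : nat -> T, forall b, B b -> exists n, f n = b.

Definition countable_dim (K : pzRingType) (M : lmodType K) : Prop :=
  exists B : M -> Prop, is_basis B /\ countable_set B.

Definition l1_term (K : pzRingType) (nr : K -> Real) (a : nat -> K) (k : nat) : Real :=
  nr (a k) / (k`!)%:R.

Definition in_l1 (K : pzRingType) (nr : K -> Real) (a : nat -> K) : Prop :=
  cvgn (series (l1_term nr a)).

Definition l1_norm (K : pzRingType) (nr : K -> Real) (a : nat -> K) : Real :=
  limn (series (l1_term nr a)).

(* l^1(K) ⊑^K M : there is a continuous K-linear injection l^1(K) -> M.
   The map is given as T : (nat -> K) -> M; only its values on l^1(K) matter. *)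
Definition l1_embeds (K : pzRingType) (nr : K -> Real) (M : lmodType K)
    (opM : (M -> Prop) -> Prop) : Prop :=
  exists T : (nat -> K) -> M,
    (forall a b, in_l1 nr a -> in_l1 nr b -> T (fun k => a k + b k) = T a + T b) /\
    (forall (r : K) a, in_l1 nr a -> T (fun k => r * a k) = r *: T a) /\
    (forall a b, in_l1 nr a -> in_l1 nr b -> T a = T b -> a = b) /\
    (forall a, in_l1 nr a -> forall U, opM U -> U (T a) ->
       exists e : Real, 0 < e /\
         forall b, in_l1 nr b -> l1_norm nr (fun k => b k - a k) < e -> U (T b)).

(* Main.v *)
(** A neighbourhood of 0 contained in a finite-dimensional subspace [F] would
    make [M] spanned by [F] and a countable dense set, so if the dimension is
    uncountable one can choose, recursively, vectors [m n] outside the span of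
    the previous ones and as small as desired.  Closed balls of [K] being
    compact, so are the sets of combinations of [m 0, ..., m (n-1)] with
    coefficients bounded by [n * i!]; hence [m n] can be taken so small that
    [r |-> \sum_i r i *: m i] converges on l^1, and that the tail cannot cancel
    a partial sum whose first nonzero coefficient has been normalised to 1.
    Conversely, the 0-1 sequences already lie in l^1 and escape every countable
    union of finite-dimensional subspaces, by a diagonal argument. *)
From mathcomp Require Import all_boot all_order all_algebra.
From mathcomp Require Import all_classical all_reals all_analysis.
From mathcomp Require Import Rstruct.
From mathcomp Require Import lra.
Require Import Defs.

Set Implicit Arguments.
Unset Strict Implicit.
Unset Printing Implicit Defensive.

Import Order.TTheory GRing.Theory Num.Theory.
Local Open Scope ring_scope.

(** * Linear algebra over a division ring *)

Section DivisionRingLinearAlgebra.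
Variables (K : unitRingType) (M : lmodType K).
Hypothesis hdiv : division_ring K.

Definition prefix_span (m : nat -> M) (n : nat) (x : M) : Prop :=
  exists c : nat -> K, x = \sum_(i < n) c i *: m i.

Lemma prefix_span0 m n : prefix_span m n 0.
Proof. by exists (fun=> 0); rewrite big1 // => i _; rewrite scale0r. Qed.

Lemma prefix_spanD m n x y :
  prefix_span m n x -> prefix_span m n y -> prefix_span m n (x + y).
Proof.
move=> [c ->] [e ->]; exists (fun i => c i + e i).
by rewrite -big_split; apply: eq_bigr => i _; rewrite scalerDl.
Qed.

Lemma prefix_spanZ m n r x : prefix_span m n x -> prefix_span m n (r *: x).
Proof.
move=> [c ->]; exists (fun i => r * c i).
by rewrite scaler_sumr; apply: eq_bigr => i _; rewrite scalerA.
Qed.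

Lemma prefix_span_sum m n (I : Type) (s : seq I) (P : pred I) (F : I -> M) :
  (forall i, P i -> prefix_span m n (F i)) ->
  prefix_span m n (\sum_(i <- s | P i) F i).
Proof.
move=> h; apply: (big_ind (prefix_span m n)) => //; first exact: prefix_span0.
by move=> x y; apply: prefix_spanD.
Qed.

Lemma prefix_span_le m n p x :
  (n <= p)%N -> prefix_span m n x -> prefix_span m p x.
Proof.
move=> np [c ->]; exists (fun i => if (i < n)%N then c i else 0).
rewrite (big_ord_widen p (fun i => c i *: m i) np) big_mkcond.
by apply: eq_bigr => i _; case: ifP; rewrite // scale0r.
Qed.

Lemma prefix_span_gen m n i : (i < n)%N -> prefix_span m n (m i).
Proof.
move=> lt_in; exists (fun j => (j == i)%:R).
rewrite (bigD1 (Ordinal lt_in)) //= eqxx scale1r big1 ?addr0 // => j.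
by rewrite -val_eqE /= => /negPf ->; rewrite scale0r.
Qed.

Lemma scaler_solve (a : K) (x y : M) : a != 0 -> a *: x + y = 0 ->
  x = (- a^-1) *: y.
Proof.
move=> a0 /eqP; rewrite addr_eq0 => /eqP e.
by rewrite scaleNr -scalerN -e scalerA mulVr ?scale1r //; apply: hdiv.
Qed.

(** A nonzero last coefficient could be divided out, which would put the last vector in the span of
    its predecessors. So it vanishes, and induction treats the others. *)
Lemma prefix_free (m : nat -> M) n :
  (forall i, (i < n)%N -> ~ prefix_span m i (m i)) ->
  forall c : nat -> K, \sum_(i < n) c i *: m i = 0 ->
  forall i, (i < n)%N -> c i = 0.
Proof.
elim: n => [//|n IH] free c.
rewrite big_ord_recr /= => eq0.
have cn : c n = 0.
  apply/eqP/negPn/negP => cn0; case: (free n (ltnSn n)).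
  rewrite addrC in eq0; rewrite (scaler_solve cn0 eq0).
  by apply: prefix_spanZ; exists c.
rewrite cn scale0r addr0 in eq0.
move=> i; rewrite ltnS leq_eqVlt => /orP[/eqP -> //|].
by apply: IH => // j jn; apply: free; apply: leq_trans jn _.
Qed.

(** Gaussian elimination with scalars kept on the left: subtracting [u i] times the pivot row clears
    the first column, and induction applies to the remaining rows and columns. The pivot row then
    receives the coefficient [c0] that undoes the subtractions. *)
Lemma left_kernel n (A : 'I_n.+1 -> 'I_n -> K) :
  exists c : 'I_n.+1 -> K, (exists i, c i != 0) /\
    forall j, \sum_i c i * A i j = 0.
Proof.
elim: n A => [|n IH] A.
  exists (fun=> 1); split; last by case.
  by exists ord0; rewrite oner_neq0.
(* A zero pivot is accepted only when the whole first column vanishes, so one elimination serves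
   both cases. *)
have [p hp] : exists p, A p ord0 = 0 -> forall i, A i ord0 = 0.
  have [h|h] := pselect (exists p, A p ord0 != 0).
    by case: h => p /negPf h; exists p => /eqP; rewrite h.
  exists ord0 => _ i; apply/eqP/negPn/negP => hi; apply: h; by exists i.
pose u i := A (lift p i) ord0 * (A p ord0)^-1.
have [c [[i ci] hc]] :=
  IH (fun i j => A (lift p i) (lift ord0 j) - u i * A p (lift ord0 j)).
pose c0 := - \sum_i c i * u i.
pose C k := if unlift p k is Some i then c i else c0.
have Cp : C p = c0 by rewrite /C unlift_none.
have Cl k : C (lift p k) = c k by rewrite /C liftK.
exists C; split; first by exists (lift p i); rewrite Cl.
move=> j; rewrite (bigD1_ord p) //= Cp.
under eq_bigr do rewrite Cl.
rewrite /c0 mulNr mulr_suml addrC; apply/eqP; rewrite subr_eq0; apply/eqP.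
case: (unliftP ord0 j) => [k|] ->; last first.
  apply: eq_bigr => k _; rewrite /u -!mulrA.
  have [e|e] := eqVneq (A p ord0) 0; first by rewrite hp // mul0r.
  by rewrite mulVr ?mulr1 //; apply: hdiv.
apply/eqP; rewrite -subr_eq0 -sumrB -[X in _ == X](hc k); apply/eqP.
by apply: eq_bigr => l _; rewrite mulrBr !mulrA.
Qed.

Lemma prefix_span_dependent (m : nat -> M) n (w : 'I_n.+1 -> M) :
  (forall i, prefix_span m n (w i)) ->
  exists c : 'I_n.+1 -> K, (exists i, c i != 0) /\ \sum_i c i *: w i = 0.
Proof.
move=> /choice[A hA].
have [c [c0 hc]] := left_kernel (fun i (j : 'I_n) => A i j).
exists c; split=> //.
under eq_bigr do rewrite hA scaler_sumr.
rewrite exchange_big big1 //= => j _.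
under eq_bigr do rewrite scalerA.
by rewrite -scaler_suml hc scale0r.
Qed.

Lemma countable_dim_spanning_seq :
  countable_dim M -> exists f : nat -> M, forall x, exists n, prefix_span f n x.
Proof.
move=> [B [[_ spB] [f hf]]]; exists f => x.
have [s [c [sB ->]]] := spB x.
elim: s sB => [|b s IH] sB; first by exists 0%N; rewrite big_nil; apply: prefix_span0.
have [n hn] : exists n, prefix_span f n (\sum_(b <- s) c b *: b).
  by apply: IH => b' b's; apply: sB; rewrite inE b's orbT.
have [k hk] : exists k, f k = b by apply: hf; apply: sB; rewrite mem_head.
exists (maxn n k.+1); rewrite big_cons; apply: prefix_spanD.
  apply: prefix_spanZ; rewrite -hk; apply: prefix_span_gen; exact: leq_maxr.
by apply: prefix_span_le hn; apply: leq_maxl.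
Qed.

(** The terms of [f] lying outside the span of the preceding ones form a basis. *)
Lemma spanning_seq_countable_dim (f : nat -> M) :
  (forall x, exists n, prefix_span f n x) -> countable_dim M.
Proof.
move=> hf; pose new i := ~ prefix_span f i (f i).
pose B b := exists i, f i = b /\ new i.
exists B; split; last by exists f => b [i [<- _]]; exists i.
split.
- move=> s c us sB eq0.
  have /choice[idx hidx] b : exists i, B b -> f i = b /\ new i.
    by have [[i hi]|nB] := pselect (B b); [exists i | exists 0%N].
  (* Induction on a bound [n] for the indices that may still carry a nonzero coefficient: a nonzero
     one at the top index would put that vector in the span of earlier terms of [f]. *)
  suff ind n : forall b, b \in s -> (idx b < n)%N ->
      (forall b', b' \in s -> (n <= idx b')%N -> c b' = 0) -> c b = 0.
    move=> b bs; pose n := (\max_(b' <- s) idx b').+1.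
    have le_n b' : b' \in s -> (idx b' < n)%N.
      by move=> b's; rewrite ltnS; apply: leq_bigmax_seq.
    apply: (ind n) => //; first exact: le_n.
    by move=> b' /le_n; rewrite ltnNge => /negPf ->.
  elim: n => [//|n IH] b bs; rewrite ltnS leq_eqVlt => lt_bn big0.
  have top b' : b' \in s -> idx b' = n -> c b' = 0.
    move=> b's eb'; apply/eqP/negPn/negP => cb0.
    have [fb nb] := hidx _ (sB _ b's); case: nb; rewrite fb.
    rewrite (bigD1_seq b') //= in eq0.
    rewrite {2}(scaler_solve cb0 eq0); apply: prefix_spanZ.
    rewrite big_seq_cond; apply: prefix_span_sum => a /andP[as_ ab].
    have [fa _] := hidx _ (sB _ as_).
    have [lt_a|le_a] := ltnP (idx a) (idx b').
      by apply: prefix_spanZ; rewrite -fa; apply: prefix_span_gen.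
    rewrite big0 ?scale0r; [exact: prefix_span0 | by [] |].
    rewrite -eb' ltn_neqAle le_a andbT; apply: contra ab => /eqP e.
    by rewrite -fb e fa.
  case/orP: lt_bn => [/eqP|lt_bn]; first exact: top.
  apply: IH => // b' b's; rewrite leq_eqVlt => /orP[/eqP e|]; last exact: big0.
  by apply: top.
- suff rep n x : prefix_span f n x -> exists c : M -> K,
      x = \sum_(b <- [seq f i | i <- iota 0 n & `[< new i >]]) c b *: b.
    move=> x; have [n /rep[c ->]] := hf x; do 2!eexists; split=> // b.
    by case/mapP=> i; rewrite mem_filter => /andP[/asboolP ni _] ->; exists i.
  elim: n x => [|n IH] x.
    by move=> [c ->]; exists (fun=> 0); rewrite big_ord0 big_nil.
  move=> [c ->]; rewrite -addn1 iotaD filter_cat map_cat /= add0n.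
  have [e he] := IH (\sum_(i < n) c i *: f i) (ex_intro _ c erefl).
  have [nn|nn] := asboolP (new n); last first.
    rewrite addn1 cats0; apply: IH; rewrite big_ord_recr /=.
    apply: prefix_spanD; first by exists c.
    by apply: prefix_spanZ; apply/not_notP.
  (* Coefficients are indexed by vectors, so [f n] must differ from the vectors already listed; it
     does, since a repeated value is not [new]. *)
  exists (fun b => if b == f n then c n else e b).
  rewrite addn1 big_ord_recr /= big_cat /= big_seq1 eqxx he; congr (_ + _).
  apply: eq_big_seq => b /mapP[i]; rewrite mem_filter mem_iota /= add0n.
  move=> /andP[_ lt_in] ->; case: eqP => // ein; case: nn.
  by rewrite -ein; apply: prefix_span_gen.
Qed.

End DivisionRingLinearAlgebra.

(** * Compactness *)

Section MetricCompactness.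
Variables (T : Type) (d : T -> T -> Real).

Definition set_ideal (U : Type) (P : (U -> Prop) -> Prop) : Prop :=
  [/\ forall A B, (forall x, A x -> B x) -> P B -> P A,
      P (fun=> False) & forall A B, P A -> P B -> P (fun x => A x \/ B x)].

(* Compactness as an induction principle: a property stable under subsets and
   finite unions that holds locally on [S] holds for [S]. *)
Definition ideal_compact (S : T -> Prop) : Prop :=
  forall P, set_ideal P ->
    (forall x, S x -> exists e : Real, 0 < e /\ P (fun y => d x y < e)) -> P S.

Hypothesis hd : is_metric d.

Lemma ball_open x (e : Real) : metric_open d (fun y => d x y < e).
Proof.
have [_ [_ [_ tri]]] := hd => y xy; exists (e - d x y).
split=> [|z yz]; first by rewrite subr_gt0.
by apply: le_lt_trans (tri x y z) _; lra.
Qed.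

(** The open members of the ideal cover [S]; a finite subcover has its union in the ideal. *)
Lemma metric_compact_ideal S : metric_compact d S -> ideal_compact S.
Proof.
have [_ [d0 _]] := hd => cS P [Pmono P0 PU] loc.
pose I := {U : T -> Prop | metric_open d U /\ P U}.
have [] := cS I (fun i => projT1 i).
- by move=> [U [oU PU']].
- move=> x Sx; have [e [e0 Pe]] := loc x Sx.
  exists (exist (fun U => metric_open d U /\ P U) _ (conj (@ball_open x e) Pe)) => /=.
  by have [_ ->] := d0 x x.
move=> s cov; apply: (Pmono _ _ cov).
elim: s {cov} => [|i s IH]; first by apply: Pmono P0 => x [i []].
apply: Pmono (PU _ _ (projT2 i).2 IH) => x [j [[->|js] Uj]]; first by left.
by right; exists j.
Qed.

Lemma ideal_compact1 x : ideal_compact (fun y => y = x).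
Proof.
have [_ [d0 _]] := hd => P [Pmono _ _] /(_ x erefl)[e [e0]].
by apply: Pmono => _ ->; have [_ ->] := d0 x x.
Qed.

End MetricCompactness.

(** The tube lemma: the first factor is localised with all of [S2] attached, then [S2] is covered at
    a fixed [x]. The radius around [x] is existential, since a union of two pieces of [S2] forces
    the smaller one. *)
Lemma tube_ideal (T1 T2 : Type) (d1 : T1 -> T1 -> Real) (d2 : T2 -> T2 -> Real)
    (S1 : T1 -> Prop) (S2 : T2 -> Prop) (P : (T1 * T2 -> Prop) -> Prop) :
  ideal_compact d1 S1 -> ideal_compact d2 S2 -> set_ideal P ->
  (forall x y, S1 x -> S2 y -> exists e : Real, 0 < e /\
     P (fun p => d1 x p.1 < e /\ d2 y p.2 < e)) ->
  P (fun p => S1 p.1 /\ S2 p.2).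
Proof.
move=> c1 c2 [Pmono P0 PU] loc.
apply: (c1 (fun A => P (fun p => A p.1 /\ S2 p.2))) => [|x S1x].
  split=> [A B AB||A B PA PB].
  - by apply: Pmono => p [/AB].
  - by apply: Pmono P0 => p [].
  - by apply: Pmono (PU _ _ PA PB) => p [[]]; [left | right].
apply: (c2 (fun B => exists e : Real, 0 < e /\ P (fun p => d1 x p.1 < e /\ B p.2))).
  split=> [A B AB [e [e0 Pe]]||A B [e [e0 Pe]] [f [f0 Pf]]].
  - by exists e; split=> //; apply: Pmono Pe => p [? /AB].
  - by exists 1; split; [exact: ltr01 | apply: Pmono P0 => p []].
  - exists (Num.min e f); split; first by rewrite lt_min e0.
    apply: Pmono (PU _ _ Pe Pf) => p; rewrite lt_min => -[/andP[xe xf]].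
    by case; [left | right].
move=> y S2y; have [e [e0 Pe]] := loc x y S1x S2y.
by exists e; split=> //; exists e.
Qed.

(** * Uniform estimates on compact sets of vectors and scalars *)

Section LinearMetric.
Variables (K : unitRingType) (nr : K -> Real) (M : lmodType K) (d : M -> M -> Real).
Hypotheses (hdiv : division_ring K) (hnorm : proper_ring_norm nr).
Hypotheses (hd : is_metric d) (hcomplete : metric_complete d).
Hypothesis muladdc : forall (a : M) (r : K) (u : M) (e : Real), 0 < e ->
  exists t : Real, 0 < t /\ forall a' r' u',
    d a a' < t -> nr (r - r') < t -> d u u' < t ->
    d (a + r *: u) (a' + r' *: u') < e.

Local Notation dK := (norm_dist nr).

Lemma dist_refl x : d x x = 0.
Proof. by have [_ [d0 _]] := hd; apply/d0. Qed.

Lemma dist_sym x y : d x y = d y x.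
Proof. by have [_ [_ [s _]]] := hd. Qed.

Lemma dist_tri x y z : d x z <= d x y + d y z.
Proof. by have [_ [_ [_ t]]] := hd. Qed.

Lemma dist_ge0 x y : 0 <= d x y.
Proof. by have [p _] := hd. Qed.

Lemma dist_eq0 x y : d x y = 0 -> x = y.
Proof. by have [_ [d0 _]] := hd; move/d0. Qed.

Lemma nr0 : nr 0 = 0.
Proof.
have [[_ [[_ [d0 _]] _]] _] := hnorm.
by have [_ /(_ erefl)] := d0 0 0; rewrite /norm_dist subrr.
Qed.

Lemma nrN x : nr (- x) = nr x.
Proof.
have [[_ [[_ [_ [s _]]] _]] _] := hnorm.
by have := s 0 x; rewrite /norm_dist sub0r subr0.
Qed.

Lemma nrD x y : nr (x + y) <= nr x + nr y.
Proof.
have [[_ [[_ [_ [_ t]]] _]] _] := hnorm.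
by have := t x 0 (- y); rewrite /norm_dist !opprK subr0 add0r.
Qed.

Lemma nrM x y : nr (x * y) <= nr x * nr y.
Proof. by have [[_ [_ h]] _] := hnorm. Qed.

Lemma nr_ge0 x : 0 <= nr x.
Proof. by have [[h _] _] := hnorm. Qed.

Lemma norm_dist_metric : is_metric dK.
Proof. by have [[_ [h _]] _] := hnorm. Qed.

Lemma ball_compact (L : Real) : ideal_compact dK (fun r => nr r <= L).
Proof.
have [_ /(_ 0 L)] := hnorm; move/(metric_compact_ideal norm_dist_metric).
congr (ideal_compact _ _); apply/funext => r.
by rewrite /norm_dist sub0r nrN.
Qed.

(** This is the image of a product of compact sets under a continuous map; the ideal is pulled back
    to the product. *)
Lemma compact_translates (A : M -> Prop) (S : K -> Prop) (u : M) :
  ideal_compact d A -> ideal_compact dK S ->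
  ideal_compact d (fun x => exists a r, [/\ A a, S r & x = a + r *: u]).
Proof.
move=> cA cS P [Pmono P0 PU] loc.
pose Q (W : M * K -> Prop) := P (fun x => exists2 p, W p & x = p.1 + p.2 *: u).
suff : Q (fun p => A p.1 /\ S p.2).
  by apply: Pmono => x [a [r [Aa Sr ->]]]; exists (a, r).
apply: (tube_ideal cA cS); rewrite /Q.
  split=> [W W' sub||W W' PW PW'].
  - by apply: Pmono => x [p /sub Wp ->]; exists p.
  - by apply: Pmono P0 => x [].
  - by apply: Pmono (PU _ _ PW PW') => x [p [] Wp ->]; [left | right]; exists p.
move=> a r Aa Sr; have [|e [e0 Pe]] := loc (a + r *: u); first by exists a, r.
have [t [t0 ht]] := muladdc a r u e0; exists t; split=> //.
by apply: Pmono Pe => x [p [ap rp] ->]; apply: ht => //; rewrite dist_refl.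
Qed.

Lemma uniformly_small (A : M -> Prop) (S : K -> Prop) (e : Real) :
  ideal_compact d A -> ideal_compact dK S -> 0 < e ->
  exists t : Real, 0 < t /\
    forall u, d 0 u < t -> forall a r, A a -> S r -> d a (a + r *: u) < e.
Proof.
move=> cA cS e0.
suff [t [t0 ht]] : exists t : Real, 0 < t /\ forall u, d 0 u < t ->
    forall p, A p.1 /\ S p.2 -> d p.1 (p.1 + p.2 *: u) < e.
  by exists t; split=> // u hu a r Aa Sr; apply: (ht u hu (a, r)).
apply: (tube_ideal cA cS (P := fun W => exists t : Real, 0 < t /\ forall u,
    d 0 u < t -> forall p, W p -> d p.1 (p.1 + p.2 *: u) < e)).
  split=> [W W' sub [t [t0 ht]]||W W' [t [t0 ht]] [s [s0 hs]]].
  - by exists t; split=> // u hu p /sub; apply: ht.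
  - by exists 1; split.
  - exists (Num.min t s); split=> [|u]; first by rewrite lt_min t0.
    by rewrite lt_min => /andP[ut us] p [/(ht u ut)|/(hs u us)].
(* One half of [e] pays for moving [a'] to [a], the other for moving from [a] to [a' + r' *: u]. *)
move=> a r Aa Sr; have e2 : 0 < e / 2 by lra.
have [t [t0 ht]] := muladdc a r 0 e2.
exists (Num.min t (e / 2)); split; first by rewrite lt_min t0.
exists t; split=> // u hu [a' r'] /=.
rewrite !lt_min => -[/andP[at_ ae] /andP[rt _]].
have := ht a' r' u at_ rt hu; rewrite scaler0 addr0 => h.
have := dist_tri a' a (a' + r' *: u); rewrite (dist_sym a' a); lra.
Qed.

Lemma compact_away0 (A : M -> Prop) : ideal_compact d A -> ~ A 0 ->
  exists t : Real, 0 < t /\ forall x, A x -> t <= d x 0.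
Proof.
move=> cA nA0.
apply: (cA (fun A => exists t : Real, 0 < t /\ forall x, A x -> t <= d x 0)).
  split=> [W W' sub [t [t0 ht]]||W W' [t [t0 ht]] [s [s0 hs]]].
  - by exists t; split=> // p /sub; apply: ht.
  - by exists 1; split.
  - exists (Num.min t s); split=> [|u]; first by rewrite lt_min t0.
    by rewrite ge_min => -[/ht ->|/hs ->] //; rewrite orbT.
move=> x Ax.
have x0 : 0 < d x 0.
  rewrite lt_neqAle dist_ge0 andbT eq_sym; apply/eqP => /dist_eq0 e.
  by apply: nA0; rewrite -e.
exists (d x 0 / 2); split; first by lra.
exists (d x 0 / 2); split=> [|y hy]; first by lra.
by have := dist_tri x y 0; lra.
Qed.

(** * Partial sums with coefficients in compact sets *)

Definition psum (m : nat -> M) (r : nat -> K) n := \sum_(i < n) r i *: m i.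

Lemma psumS m r n : psum m r n.+1 = psum m r n + r n *: m n.
Proof. exact: big_ord_recr. Qed.

Lemma psum_compact (m : nat -> M) (S : nat -> K -> Prop) n :
  (forall k, ideal_compact dK (S k)) ->
  ideal_compact d (fun x => exists r,
    (forall k, (k < n)%N -> S k (r k)) /\ x = psum m r n).
Proof.
move=> cS; elim: n => [|n IH].
  rewrite (_ : (fun x => _) = (fun x => x = 0)); first exact: ideal_compact1.
  apply/funext => x; apply/propext; rewrite /psum; split=> [[r [_ ->]]|->].
    by rewrite big_ord0.
  by exists (fun=> 0); rewrite big_ord0.
rewrite (_ : (fun x => _) = (fun x => exists a r,
  [/\ exists c, (forall k, (k < n)%N -> S k (c k)) /\ a = psum m c n,
      S n r & x = a + r *: m n])); first exact: compact_translates.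
apply/funext => x; apply/propext; split=> [[c [hc ->]]|[_ [r [[c [hc ->]] Sr ->]]]].
  exists (psum m c n), (c n); split; last exact: psumS; last exact: hc.
  by exists c; split=> // k kn; apply: hc; apply: ltnW.
exists (fun k => if (k < n)%N then c k else r); split=> [k|].
  by rewrite ltnS leq_eqVlt; case: ltnP => [/hc //|_]; rewrite orbF => /eqP ->.
rewrite psumS ltnn; congr (_ + _).
by apply: eq_bigr => i _; rewrite ltn_ord.
Qed.


(** The factorial matches the weights of l^1. The constant is a natural number so that stage [n] of
    the construction can use [n] itself, which eventually exceeds any fixed [C]. *)
Definition dominated (r : nat -> K) (C n : nat) : Prop :=
  forall i, (i < n)%N -> nr (r i) <= C%:R * (i`!)%:R.

(** For a fixed leading index the admissible sums form a compact set, which misses 0 by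
    independence. The induction on [p] takes the minimum over the finitely many leading indices. *)
Lemma normalized_psum_away0 (m : nat -> M) n :
  (forall i, (i < n)%N -> ~ prefix_span m i (m i)) ->
  exists e : Real, 0 < e /\ forall k r, (k < n)%N ->
    (forall i, (i < k)%N -> r i = 0) -> r k = 1 -> dominated r n n ->
    e <= d (psum m r n) 0.
Proof.
move=> free.
suff ind p : (p <= n)%N -> exists e : Real, 0 < e /\ forall k r, (k < p)%N ->
    (forall i, (i < k)%N -> r i = 0) -> r k = 1 -> dominated r n n ->
    e <= d (psum m r n) 0 by exact: ind.
elim: p => [_|k IH kn]; first by exists 1; split.
have [e [e0 he]] := IH (ltnW kn).
pose S j (x : K) := if (j < k)%N then x = 0 else if j == k then x = 1
  else nr x <= n%:R * (j`!)%:R.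
have cS j : ideal_compact dK (S j).
  rewrite /S; case: ltnP => _; first exact: ideal_compact1 norm_dist_metric _.
  by case: eqP => _; [exact: ideal_compact1 norm_dist_metric _ | exact: ball_compact].
have [|t [t0 ht]] := compact_away0 (psum_compact (m := m) (n := n) cS).
  move=> [r [hr /esym r0]]; have := hr k kn; rewrite /S ltnn eqxx => rk.
  by have := prefix_free hdiv free r0 kn; rewrite rk => /eqP; rewrite oner_eq0.
exists (Num.min e t); split=> [|j r]; first by rewrite lt_min e0.
rewrite ltnS leq_eqVlt ge_min => /orP[/eqP ->|jk] r0 r1 rn; last first.
  by rewrite (he j).
rewrite ht ?orbT //; exists r; split=> // i lt_in; rewrite /S.
case: ltnP => [/r0 //|_]; case: eqP => [->//|_]; exact: rn.
Qed.

Lemma dominated_compact (m : nat -> M) (C n : nat) :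
  ideal_compact d (fun x => exists r, dominated r C n /\ x = psum m r n).
Proof.
apply: (psum_compact (S := fun k x => nr x <= C%:R * (k`!)%:R)) => k.
exact: ball_compact.
Qed.

(** Otherwise a ball around 0 lies in one prefix span, every vector differs from some [D k] by an
    element of it, and [m] followed by [D] spans. *)
Lemma not_countable_dim_small_outside (D : nat -> M) :
  (forall x (e : Real), 0 < e -> exists k, d x (D k) < e) ->
  ~ countable_dim M ->
  forall (m : nat -> M) n (e : Real), 0 < e ->
    exists u, d 0 u < e /\ ~ prefix_span m n u.
Proof.
move=> dense ncd m n e e0; apply: contrapT => /forallNP inside; apply: ncd.
pose f i := if (i < n)%N then m i else D (i - n)%N.
apply: (spanning_seq_countable_dim hdiv (f := f)) => x.
(* The metric need not be translation invariant; continuity of subtraction turns [D k] close to [x]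
   into [x - D k] close to 0. *)
have [t [t0 ht]] := muladdc x (-1) x e0.
have [k hk] := dense x t t0.
have : prefix_span m n (x - D k).
  have /not_andP[] // := inside (x - D k); last exact: contrapT.
  have := ht x (-1) (D k); rewrite !scaleN1r !subrr nr0 dist_refl.
  by move=> ->.
move=> [c hc]; exists (n + k).+1; rewrite -[x](subrK (D k)).
apply: prefix_spanD; last first.
  have -> : D k = f (n + k)%N by rewrite /f ltnNge leq_addr addKn.
  exact: prefix_span_gen.
apply: (prefix_span_le (n := n)); first by rewrite -addnS leq_addr.
by exists c; rewrite hc; apply: eq_bigr => i _; rewrite /f ltn_ord.
Qed.

(** * Recursive choice of an independent, fast decreasing sequence *)

Hypothesis small_outside : forall (m : nat -> M) n (e : Real), 0 < e ->
  exists u, d 0 u < e /\ ~ prefix_span m n u.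

(** The vector has to be chosen before the coefficients; compactness supplies a size that works for
    all of them. *)
Lemma next_vector (m : nat -> M) n (e : Real) : 0 < e ->
  exists u, ~ prefix_span m n u /\ forall r, dominated r n n.+1 ->
    d (psum m r n) (psum m r n + r n *: u) < e.
Proof.
move=> e0.
have [t [t0 ht]] := uniformly_small (@dominated_compact m n n)
  (@ball_compact (n%:R * (n`!)%:R)) e0.
have [u [u0 nu]] := small_outside m n t0.
exists u; split=> // r hr; apply: ht => //; last exact: hr.
by exists r; split=> // i lt_in; apply: hr; apply: ltnW.
Qed.

(** Dependent choice in which each term may depend on the whole list of earlier ones, with [good] as
    the invariant. *)
Lemma history_choice (X : Type) (good : seq X -> Prop) (Q : seq X -> X -> Prop) :
  good [::] -> (forall s, good s -> exists x, Q s x /\ good (rcons s x)) ->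
  exists f : nat -> X, forall n, Q (mkseq f n) (f n).
Proof.
move=> g0 step.
have /choice[nxt hnxt] s : exists x, good s -> Q s x /\ good (rcons s x).
  have [/step[x hx]|ng] := pselect (good s); first by exists x.
  by have [x _] := step _ g0; exists x.
pose fix hist n := if n is n'.+1 then rcons (hist n') (nxt (hist n')) else [::].
have hgood n : good (hist n) by elim: n => [//|n /hnxt[]].
have histE n : mkseq (nxt \o hist) n = hist n.
  by elim: n => [//|n IH]; rewrite mkseqS IH.
by exists (nxt \o hist) => n; rewrite histE; have [] := hnxt _ (hgood n).
Qed.

(* The tail of a series from [n] on moves the sum by at most [2 * delta n], which
   the factor 3 beats. *)
Definition fast_decreasing (m : nat -> M) (delta : nat -> Real) : Prop :=
  [/\ forall n, 0 < delta n, delta 0%N <= 1,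
      forall n, delta n.+1 <= delta n / 2,
      forall n k r, (k < n)%N -> (forall i, (i < k)%N -> r i = 0) -> r k = 1 ->
        dominated r n n -> 3 * delta n <= d (psum m r n) 0
    & forall n r, dominated r n n.+1 ->
        d (psum m r n) (psum m r n.+1) < delta n].

Lemma exists_fast_decreasing : exists m delta, fast_decreasing m delta.
Proof.
pose vec (s : seq (M * Real)) i := (nth (0, 1) s i).1.
(* On the empty list this is 1, so the halving condition also bounds [delta 0]. *)
pose prev (s : seq (M * Real)) := (last (0, 1) s).2.
pose good s := 0 < prev s /\
  forall i, (i < size s)%N -> ~ prefix_span (vec s) i (vec s i).
pose Q s (p : M * Real) :=
  [/\ 0 < p.2, p.2 <= prev s / 2,
      forall k r, (k < size s)%N -> (forall i, (i < k)%N -> r i = 0) -> r k = 1 ->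
        dominated r (size s) (size s) -> 3 * p.2 <= d (psum (vec s) r (size s)) 0
    & forall r, dominated r (size s) (size s).+1 ->
        d (psum (vec s) r (size s)) (psum (vec s) r (size s) + r (size s) *: p.1)
          < p.2].
have psum_eq (m m' : nat -> M) n r : (forall i, (i < n)%N -> m i = m' i) ->
    psum m r n = psum m' r n.
  by move=> e; apply: eq_bigr => i _; rewrite e.
have [||f hf] := @history_choice _ good Q.
- by split; [exact: ltr01 | ].
- move=> s [prev0 free]; have [e [e0 he]] := normalized_psum_away0 free.
  (* The first bound gives the halving, the second the factor 3 against the distance [e] from 0. *)
  pose t := Num.min (prev s / 2) (e / 3).
  have t0 : 0 < t by rewrite lt_min; apply/andP; split; lra.
  have [te tp] : t <= e / 3 /\ t <= prev s / 2.
    by rewrite !ge_min !lexx orbT.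
  have [u [nu hu]] := next_vector (vec s) (size s) t0.
  exists (u, t); split; first split=> //= k r hk r0 r1 rn.
    by have := he k r hk r0 r1 rn; lra.
  split=> [|i]; first by rewrite /prev last_rcons.
  have vecE j : (j < size s)%N -> vec (rcons s (u, t)) j = vec s j.
    by move=> hj; rewrite /vec nth_rcons hj.
  rewrite size_rcons ltnS => his [c hc].
  have eqs : vec (rcons s (u, t)) i = psum (vec s) c i.
    by rewrite hc; apply: psum_eq => j ji; apply: vecE; apply: leq_trans his.
  case: ltngtP his eqs => // [his|->] _ eqs.
    by apply: (free i his); exists c; rewrite -vecE.
  by apply: nu; exists c; rewrite -[RHS]eqs /vec nth_rcons ltnn eqxx.
have vecE n i : (i < n)%N -> vec (mkseq f n) i = (f i).1.
  by move=> hi; rewrite /vec nth_mkseq.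
exists (fun n => (f n).1), (fun n => (f n).2); split.
- by move=> n; have [] := hf n.
- by have [_ h _ _] := hf 0%N; rewrite /prev /= in h; lra.
- by move=> n; have [_ + _ _] := hf n.+1; rewrite /prev mkseqS last_rcons.
- move=> n k r; have [_ _ + _] := hf n; rewrite size_mkseq => h hk r0 r1 rn.
  by have := h k r hk r0 r1 rn; rewrite (psum_eq _ _ _ _ (vecE n)).
- move=> n r; have [_ _ _ +] := hf n; rewrite size_mkseq => h rn.
  by have := h r rn; rewrite (psum_eq _ _ _ _ (vecE n)) psumS.
Qed.

(** * The map from l^1 *)

Lemma l1_term_ge0 a k : 0 <= l1_term nr a k.
Proof. by rewrite divr_ge0 ?nr_ge0 ?ler0n. Qed.

Lemma l1_term_le a k (e : Real) :
  (l1_term nr a k <= e) = (nr (a k) <= e * (k`!)%:R).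
Proof. by rewrite ler_pdivrMr // ltr0n fact_gt0. Qed.

Lemma in_l1D a b : in_l1 nr a -> in_l1 nr b -> in_l1 nr (fun k => a k + b k).
Proof.
move=> ha hb; apply: series_le_cvg (is_cvg_seriesD ha hb).
- exact: l1_term_ge0.
- by move=> k; rewrite addr_ge0 ?l1_term_ge0.
- move=> k; rewrite -[leRHS]/(nr (a k) / _ + nr (b k) / _) -mulrDl ler_wpM2r ?invr_ge0 ?ler0n //.
  exact: nrD.
Qed.

Lemma in_l1Z r a : in_l1 nr a -> in_l1 nr (fun k => r * a k).
Proof.
move=> ha; apply: series_le_cvg (is_cvg_seriesZ (k := nr r) ha).
- exact: l1_term_ge0.
- by move=> k; rewrite mulr_ge0 ?l1_term_ge0 ?nr_ge0.
- move=> k; rewrite -[leRHS]/(nr r * (nr (a k) / _)) mulrA.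
  by rewrite ler_wpM2r ?invr_ge0 ?ler0n //; apply: nrM.
Qed.

(** Comparison with [L] times the exponential series at 1. *)
Lemma in_l1_bounded a (L : Real) : (forall k, nr (a k) <= L) -> in_l1 nr a.
Proof.
move=> ha; have := is_cvg_series_exp_coeff (1 : Real).
move/(is_cvg_seriesZ (k := L)); apply: series_le_cvg.
- exact: l1_term_ge0.
- move=> k; rewrite mulr_ge0 ?(le_trans (nr_ge0 _) (ha k)) //.
  by rewrite /exp_coeff /= expr1n divr_ge0 ?ler01 ?ler0n.
- move=> k; rewrite -[leRHS]/(L * (1 ^+ k / (k`!)%:R)) expr1n div1r.
  by rewrite ler_wpM2r ?invr_ge0 ?ler0n.
Qed.

Lemma l1_term_le_norm a k : in_l1 nr a -> l1_term nr a k <= l1_norm nr a.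
Proof.
move=> ha; have inc : nondecreasing_seq (series (l1_term nr a)).
  by apply: nondecreasing_series => i _ _; exact: l1_term_ge0.
apply: le_trans (nondecreasing_cvgn_le inc ha k.+1).
rewrite /series /= big_nat_recr //= lerDr.
by apply: sumr_ge0 => i _; exact: l1_term_ge0.
Qed.

(** A consequence of membership in l^1 that already suffices for convergence and injectivity. *)
Definition factorial_growth (a : nat -> K) : Prop :=
  exists C, forall n, dominated a C n.

Lemma in_l1_factorial_growth a : in_l1 nr a -> factorial_growth a.
Proof.
move=> ha; exists (Num.truncn (l1_norm nr a)).+1 => n k _.
rewrite -l1_term_le; apply: le_trans (l1_term_le_norm k ha) _.
exact/ltW/truncnS_gt.
Qed.

Section SeriesMap.
Variables (m : nat -> M) (delta : nat -> Real).
Hypothesis hm : fast_decreasing m delta.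

Definition tends (u : nat -> M) (l : M) : Prop :=
  forall e : Real, 0 < e -> exists N, forall n, (N <= n)%N -> d (u n) l < e.

Lemma tends_unique u l l' : tends u l -> tends u l' -> l = l'.
Proof.
move=> hl hl'; apply: dist_eq0; apply/eqP; rewrite eq_le dist_ge0 andbT leNgt.
apply/negP => pos; have e0 : 0 < d l l' / 2 by lra.
have [N hN] := hl _ e0; have [N' hN'] := hl' _ e0.
have := hN _ (leq_maxl N N'); have := hN' _ (leq_maxr N N').
have := dist_tri l (u (maxn N N')) l'; rewrite (dist_sym l (u _)); lra.
Qed.

Lemma tendsDZ u v l l' r : tends u l -> tends v l' ->
  tends (fun n => u n + r *: v n) (l + r *: l').
Proof.
move=> hu hv e e0; have [t [t0 ht]] := muladdc l r l' e0.
have [N hN] := hu _ t0; have [N' hN'] := hv _ t0.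
exists (maxn N N') => n; rewrite geq_max => /andP[Nn N'n].
rewrite dist_sym; apply: ht; rewrite ?subrr ?nr0 //; rewrite dist_sym; auto.
Qed.

Lemma tends_eq u v l : (forall n, u n = v n) -> tends u l -> tends v l.
Proof. by move=> /funext ->. Qed.

Lemma tends_cst x : tends (fun=> x) x.
Proof. by move=> e e0; exists 0%N => n _; rewrite dist_refl. Qed.

(** Step [p] costs less than [delta p], which by halving is at most [2 * delta p - 2 * delta p.+1],
    and the sum telescopes. From [C] on, domination by [C] implies domination by the stage
    number. *)
Lemma dist_psum a C n p : (forall q, dominated a C q) -> (C <= n)%N -> (n <= p)%N ->
  d (psum m a n) (psum m a p) <= 2 * delta n - 2 * delta p.
Proof.
move=> ha Cn; have [d0 _ d2 _ d4] := hm.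
elim: p => [|p IH]; first by rewrite leqn0 => /eqP ->; rewrite dist_refl; lra.
rewrite leq_eqVlt => /orP[/eqP <-|np]; first by rewrite dist_refl; lra.
have /d4 h : dominated a p p.+1.
  move=> i ip; apply: le_trans (ha _ _ ip) _.
  by rewrite ler_wpM2r ?ler0n // ler_nat (leq_trans Cn).
have := dist_tri (psum m a n) (psum m a p) (psum m a p.+1).
by have := IH np; have := d2 p; lra.
Qed.

Lemma delta_small (e : Real) : 0 < e -> exists N, 2 * delta N < e.
Proof.
move=> e0; have [d0 d1 d2 _ _] := hm.
(* This harmonic bound is weaker than the geometric one but yields [N] directly as the integer part
   of [2 / e]. *)
have dn n : delta n * n.+1%:R <= 1.
  elim: n => [|n IH]; first by rewrite mulr1.
  apply: le_trans IH; have := d2 n; have := d0 n.+1.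
  rewrite -[n.+2%:R]natr1 -[n.+1%:R]natr1.
  have : 0 <= n%:R :> Real by rewrite ler0n.
  nra.
pose N := Num.truncn (2 / e); exists N.
have hN : 2 / e < N.+1%:R by exact: truncnS_gt.
rewrite ltr_pdivrMr // in hN.
have := dn N; have := d0 N; nra.
Qed.

Lemma psum_cvg a : factorial_growth a -> exists l, tends (psum m a) l.
Proof.
move=> [C hC]; apply: hcomplete => e e0; have [d0 _ _ _ _] := hm.
have e2 : 0 < e / 2 by lra.
have [N hN] := delta_small e2.
have [N' [CN' hN']] : exists N', (C <= N')%N /\ 2 * delta N' < e / 2.
  exists (maxn C N); split; first exact: leq_maxl.
  apply: le_lt_trans hN; rewrite ler_pM2l //.
  have [_ _ d2 _ _] := hm.
  have mono n p : (n <= p)%N -> delta p <= delta n.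
    elim: p => [|p IH]; first by rewrite leqn0 => /eqP ->.
    rewrite leq_eqVlt => /orP[/eqP -> //|/IH h].
    by have := d2 p; have := d0 p; lra.
  exact/mono/leq_maxr.
exists N' => p q hp hq.
have := dist_psum hC CN' hp; have := dist_psum hC CN' hq.
have := d0 p; have := d0 q.
have := dist_tri (psum m a p) (psum m a N') (psum m a q).
by rewrite (dist_sym (psum m a p) (psum m a N')); lra.
Qed.

Lemma dist_psum_lim a l C n : (forall q, dominated a C q) -> (C <= n)%N ->
  tends (psum m a) l -> d (psum m a n) l <= 2 * delta n.
Proof.
move=> ha Cn hl; rewrite leNgt; apply/negP => lt_d; have [d0 _ _ _ _] := hm.
have e0 : 0 < d (psum m a n) l - 2 * delta n by lra.
have [N hN] := hl _ e0.
have := hN _ (leq_maxl N n); have := dist_psum ha Cn (leq_maxr N n).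
have := dist_tri (psum m a n) (psum m a (maxn N n)) l.
by have := d0 (maxn N n); lra.
Qed.

Lemma psumD a b n : psum m (fun k => a k + b k) n = psum m a n + psum m b n.
Proof.
by rewrite /psum -big_split; apply: eq_bigr => i _; rewrite scalerDl.
Qed.

Lemma psumZ r a n : psum m (fun k => r * a k) n = r *: psum m a n.
Proof.
by rewrite /psum scaler_sumr; apply: eq_bigr => i _; rewrite scalerA.
Qed.

Lemma factorial_growthZ r a : factorial_growth a -> factorial_growth (fun k => r * a k).
Proof.
move=> [C hC]; exists ((Num.truncn (nr r)).+1 * C)%N => n i ni.
apply: le_trans (nrM _ _) _; rewrite natrM -mulrA.
by rewrite ler_pM ?nr_ge0 // ?(hC n) //; apply/ltW/truncnS_gt.
Qed.

(** Dividing by the first nonzero coefficient gives a partial sum at distance at least [3 * delta n]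
    from 0, while convergence to 0 allows only [2 * delta n]. *)
Lemma psum_tends0 c : factorial_growth c -> tends (psum m c) 0 -> c = fun=> 0.
Proof.
move=> gc hc; apply/funext.
suff ind n : forall i, (i < n)%N -> c i = 0 by move=> k; apply: (ind k.+1).
elim: n => [//|k IH] i; rewrite ltnS leq_eqVlt => /orP[/eqP ->|]; last exact: IH.
apply/eqP/negPn/negP => ck.
pose b i := (c k)^-1 * c i.
have [C hC] := factorial_growthZ (c k)^-1 gc.
have tb : tends (psum m b) 0.
  have := tendsDZ (c k)^-1 (tends_cst 0) hc; rewrite scaler0 addr0.
  by apply: tends_eq => n; rewrite add0r -psumZ.
have [d0 _ _ d3 _] := hm.
(* Large enough for the tail estimate and for the leading index [k] to occur in the sum. *)
pose n := maxn C k.+1.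
have : 3 * delta n <= d (psum m b n) 0.
  apply: (d3 n k) => [|j jk||j jn].
  - exact: leq_maxr.
  - by rewrite /b (IH j jk) mulr0.
  - by rewrite /b mulVr //; apply: hdiv.
  - apply: le_trans (hC _ _ jn) _.
    by rewrite ler_wpM2r ?ler0n // ler_nat leq_maxl.
have := dist_psum_lim hC (leq_maxl C k.+1) tb.
by have := d0 n; rewrite -/n -/b; lra.
Qed.

Lemma psum_near0 n (e : Real) : 0 < e -> exists t : Real, 0 < t /\
  forall c, (forall i, (i < n)%N -> nr (c i) < t) -> d 0 (psum m c n) < e.
Proof.
elim: n e => [|n IH] e e0.
  by exists 1; split=> // c _; rewrite /psum big_ord0 dist_refl.
have [t [t0 ht]] := muladdc 0 0 (m n) e0.
have [s [s0 hs]] := IH _ t0.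
exists (Num.min s t); split=> [|c hc]; first by rewrite lt_min s0.
have hc' i : (i < n.+1)%N -> nr (c i) < s /\ nr (c i) < t.
  by move=> /hc; rewrite lt_min => /andP.
rewrite psumS -[0 in X in X < _](_ : 0 + 0 *: m n = 0); last first.
  by rewrite scale0r addr0.
apply: ht.
- by apply: hs => i /ltnW /hc'[].
- by rewrite sub0r nrN; have [] := hc' n (ltnSn n).
- by rewrite dist_refl.
Qed.

(** For continuity at [a], the image of [b - a] is split at a fixed [n]: finitely many small
    coefficients control the head, and domination by 1 controls the tail uniformly in [b]. *)
Lemma series_map_embeds (opM : (M -> Prop) -> Prop) :
  (forall U, opM U <-> metric_open d U) -> l1_embeds nr opM.
Proof.
move=> hop.
(* [T] is total, with the dummy value 0 where convergence is not guaranteed. *)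
have /choice[T hT] a : exists l, factorial_growth a -> tends (psum m a) l.
  have [/psum_cvg[l hl]|na] := pselect (factorial_growth a); first by exists l.
  by exists 0.
have hT1 a : in_l1 nr a -> tends (psum m a) (T a).
  by move/in_l1_factorial_growth/hT.
have TDZ a b r : in_l1 nr a -> in_l1 nr b ->
    T (fun k => a k + r * b k) = T a + r *: T b.
  move=> ha hb; have /= h := hT1 _ (in_l1D ha (in_l1Z (r := r) hb)); apply: (tends_unique h).
  apply: tends_eq (tendsDZ r (hT1 _ ha) (hT1 _ hb)) => n.
  by rewrite psumD psumZ.
have in0 : in_l1 nr (fun=> 0) by apply: (in_l1_bounded (L := 0)) => k; rewrite nr0.
have T0 : T (fun=> 0) = 0.
  apply: tends_unique (hT1 _ in0) _; apply: tends_eq (tends_cst 0) => n.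
  by rewrite /psum big1 // => i _; rewrite scale0r.
have TB a b : in_l1 nr a -> in_l1 nr b -> T (fun k => a k - b k) = T a - T b.
  move=> ha hb; rewrite -[- T b]scaleN1r -TDZ //; congr T.
  by apply/funext => k; rewrite mulN1r.
have in_l1B a b : in_l1 nr a -> in_l1 nr b -> in_l1 nr (fun k => a k - b k).
  move=> ha hb; have := in_l1D ha (in_l1Z (r := -1) hb).
  by under eq_fun do rewrite mulN1r.
exists T; split; [|split; [|split]].
- move=> a b ha hb; rewrite -[T b]scale1r -TDZ //; congr T.
  by apply/funext => k; rewrite mul1r.
- move=> r a ha; rewrite -[RHS]add0r -T0 -TDZ //; congr T.
  by apply/funext => k; rewrite add0r.
- move=> a b ha hb eT; have hc := in_l1B _ _ ha hb.
  have := hT1 _ hc; rewrite TB // eT subrr.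
  move/(psum_tends0 (in_l1_factorial_growth hc)) => c0; apply/funext => k.
  by apply/eqP; rewrite -subr_eq0; apply/eqP; have := congr1 (fun f => f k) c0.
move=> a ha U /hop oU /oU[e [e0 he]].
have [t [t0 ht]] := muladdc (T a) 1 0 e0.
have t2 : 0 < t / 2 by lra.
have [N hN] := delta_small t2.
(* The successor ensures [1 <= n], as the tail estimate with [C = 1] requires. *)
pose n := N.+1.
have [d0 _ d2 _ _] := hm.
have hn : 2 * delta n < t / 2.
  by have := d2 N; have := d0 N; rewrite /n; lra.
have [s [s0 hs]] := psum_near0 n t2.
(* [L] bounds every factorial weight below [n], so a norm under [s / L] makes those coefficients
   smaller than [s]; the bound 1 in the minimum gives [dom]. *)
pose L : Real := \sum_(i < n) (i`!)%:R.
have le_L i : (i < n)%N -> (i`!)%:R <= L.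
  move=> lt_in; rewrite /L (bigD1 (Ordinal lt_in)) //= lerDl.
  by apply: sumr_ge0 => j _; rewrite ler0n.
have L0 : 0 < L by apply: lt_le_trans (le_L 0%N _) => //; rewrite ltr0n.
exists (Num.min 1 (s / L)); split; first by rewrite lt_min ltr01 divr_gt0.
move=> b hb; rewrite lt_min => /andP[b1 bs].
pose c k := b k - a k; have hc : in_l1 nr c by exact: in_l1B.
have dom q : dominated c 1 q.
  move=> i _; rewrite -l1_term_le; apply: le_trans (l1_term_le_norm i hc) _.
  exact: ltW.
have small i : (i < n)%N -> nr (c i) < s.
  move=> lt_in; rewrite ltr_pdivlMr // in bs; apply: le_lt_trans bs.
  apply: (@le_trans _ _ (l1_norm nr c * (i`!)%:R)).
    by rewrite -l1_term_le l1_term_le_norm.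
  rewrite ler_wpM2l ?le_L //.
  exact: le_trans (l1_term_ge0 c 0) (l1_term_le_norm 0 hc).
have Tc : d 0 (T c) < t.
  have := dist_psum_lim (n := n) dom isT (hT1 _ hc); have := hs _ small.
  by have := dist_tri 0 (psum m c n) (T c); lra.
apply: he; rewrite -[T b](subrKC (T a)) -(TB b a) // -/c.
rewrite -{1}[T a]addr0 -[0 in X in d X _](scale1r 0) -[T c]scale1r.
by apply: ht => //; rewrite ?dist_refl // subrr nr0.
Qed.

End SeriesMap.

(** * The dimension of l^1 *)

(** Coding pairs by [pickle] makes the coordinate blocks disjoint, so a single 0-1 sequence can
    avoid all prefix spans at once. *)
Lemma l1_embeds_not_countable_dim (opM : (M -> Prop) -> Prop) :
  l1_embeds nr opM -> ~ countable_dim M.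
Proof.
move=> [T [TD [TZ [Tinj _]]]] /countable_dim_spanning_seq[f hf].
have in0 : in_l1 nr (fun=> 0) by apply: (in_l1_bounded (L := 0)) => k; rewrite nr0.
have T0 : T (fun=> 0) = 0.
  by have := TZ 0 _ in0; rewrite scale0r => <-; congr T; apply/funext => k; rewrite mul0r.
have Tsum (I : Type) (s : seq I) (c : I -> K) (y : I -> nat -> K) :
    (forall i, in_l1 nr (y i)) ->
    in_l1 nr (fun k => \sum_(i <- s) c i * y i k) /\
    T (fun k => \sum_(i <- s) c i * y i k) = \sum_(i <- s) c i *: T (y i).
  move=> hy; elim: s => [|i s [IH1 IH2]].
    by rewrite big_nil; under eq_fun do rewrite big_nil.
  rewrite big_cons -IH2 -TZ // -TD //; last exact: in_l1Z.
  under eq_fun do rewrite big_cons.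
  by split=> //; apply: in_l1D => //; exact: in_l1Z.
(* [T] maps {y | T y in prefix_span f n} injectively into a space of dimension
   at most n, so its elements cannot realise all n + 1 unit vectors on a block
   of n + 1 coordinates. *)
have /choice[I hI] n : exists i, forall y, in_l1 nr y -> prefix_span f n (T y) ->
    ~ forall j, (j <= n)%N -> y (pickle (n, j)) = (j == i)%:R.
  apply: contrapT => /forallNP hn.
  have /choice[y hy] (i : 'I_n.+1) : exists y, [/\ in_l1 nr y,
      prefix_span f n (T y) &
      forall j, (j <= n)%N -> y (pickle (n, j)) = (j == i)%:R].
    apply: contrapT => /forallNP hy; apply: (hn i) => y y1 y2 y3.
    by apply: (hy y).
  have yl1 i : in_l1 nr (y i) by have [] := hy i.
  have [|c [[j cj] hc]] := prefix_span_dependent hdiv (w := fun i => T (y i)) (m := f).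
    by move=> i; have [] := hy i.
  have [s1 s2] := Tsum _ (index_enum 'I_n.+1) c y yl1.
  (* Injectivity makes the combination of the [y i] vanish as a sequence, and this coordinate
     isolates [c j]. *)
  have /(congr1 (fun g => g (pickle (n, val j)))) := Tinj _ _ s1 in0 (etrans s2 (etrans hc (esym T0))).
  rewrite (bigD1 j) //= big1 => [|i ij].
    have [_ _ ->] := hy j; last by rewrite -ltnS.
    by rewrite eqxx mulr1 addr0 => /eqP; apply/negP.
  have [_ _ ->] := hy i; last by rewrite -ltnS.
  by rewrite val_eqE eq_sym (negPf ij) mulr0.
(* The diagonal sequence: block [n] carries the forbidden pattern [I n]. *)
pose x k : K := if unpickle k is Some (n, j) then (j == I n)%:R else 0.
have hx : in_l1 nr x.
  apply: (in_l1_bounded (L := nr 1)) => k; rewrite /x.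
  by case: unpickle => [[n j]|]; [case: (j == _) | ]; rewrite ?nr0 ?nr_ge0.
have [n hn] := hf (T x).
by apply: (hI n x hx hn) => j _; rewrite /x pickleK.
Qed.

End LinearMetric.

(** * From Polish modules to metric estimates, and the dichotomy *)

(** Continuity of addition at [(a, r *: u)] is combined with continuity of scaling at [(r, u)], and
    the open sets are replaced by balls. *)
Lemma polish_module_muladdc (K : unitRingType) (nr : K -> Real)
    (hnorm : proper_ring_norm nr) (M : lmodType K) (opM : (M -> Prop) -> Prop)
    (d : M -> M -> Real) :
  topological_module nr opM -> is_metric d ->
  (forall U, opM U <-> metric_open d U) ->
  forall (a : M) (r : K) (u : M) (e : Real), 0 < e ->
  exists t : Real, 0 < t /\ forall a' r' u',
    d a a' < t -> nr (r - r') < t -> d u u' < t ->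
    d (a + r *: u) (a' + r' *: u') < e.
Proof.
move=> [addc scalec] hd hop a r u e e0.
have oB : opM (fun y => d (a + r *: u) y < e) by apply/hop/ball_open.
have [|V [W [/hop oV [oW [Va [Wu VW]]]]]] := addc _ oB a (r *: u).
  by have [_ [d0 _]] := hd; have [_ ->] := d0 (a + r *: u) (a + r *: u).
have [s [s0 [W' [/hop oW' [W'u hW']]]]] := scalec _ oW r u Wu.
have [t1 [t10 ht1]] := oV a Va; have [t2 [t20 ht2]] := oW' u W'u.
exists (Num.min s (Num.min t1 t2)); split=> [|a' r' u'].
  by rewrite !lt_min s0 t10.
rewrite !lt_min => /and3P[_ aa' _] /and3P[rr' _ _] /and3P[_ _ uu'].
apply: VW; first exact: ht1.
apply: hW'; last exact: ht2.
by rewrite -opprB (nrN hnorm).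
Qed.

Theorem theorem1p1 (K : unitRingType) (nr : K -> Defs.Real)
    (hdiv : division_ring K) (hnorm : proper_ring_norm nr)
    (M : lmodType K) (opM : (M -> Prop) -> Prop) (hM : polish_module nr opM) :
  (countable_dim M /\ ~ l1_embeds nr opM) \/ (~ countable_dim M /\ l1_embeds nr opM).
Proof.
have [tm [[d [hd [hcomplete hop]]] [D hD]]] := hM.
have muladdc := polish_module_muladdc hnorm tm hd hop.
have [cd|ncd] := pselect (countable_dim M); [left|right]; split=> //.
  by move/(l1_embeds_not_countable_dim hdiv hnorm).
have dense x (e : Real) : 0 < e -> exists k, d x (D k) < e.
  move=> e0; apply: (hD (fun y => d x y < e) _ x); first exact/hop/ball_open.
  by rewrite (dist_refl hd).
have [m [delta hm]] := exists_fast_decreasing hdiv hnorm hd muladdc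
  (not_countable_dim_small_outside hdiv hnorm hd muladdc dense ncd).
exact: (series_map_embeds hdiv hnorm hd hcomplete muladdc hm hop).
Qed.
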